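(* Let $S$ be a commutative ring and $R$ a subring of $S$ which is an integral domain. Assume that $S$ is a free $R$-module of finite rank $n$ and that the $\overline{k}$-algebra $\overline{k}\otimes_RS$ (where $k$ is the quotient field of $R$ and $\overline{k}$ its algebraic closure) is semisimple. Let $T'=T\cap\operatorname{SL}(n,R)$ and assume that $T'$ is Zariski dense in $\widetilde T\cap\operatorname{SL}(n,\overline{k})$. Then the lower garland of the lattice $\mathrm{Lat}(T',\operatorname{SL}(n,R))$ is equal to the interval $\mathrm{Lat}(T',N_{\operatorname{SL}(n,R)}(T'))$.
   Context: Rings are associative with unit, subrings are unitary. Fix an $R$-basis $\omega_1,\dots,\omega_n$ of $S$. For $\alpha\in S$ let $t(\alpha)=(t_{ij}(\alpha))\in M(n,R)$ be given by $\omega_i\alpha=\sum_{j=1}^n t_{ji}(\alpha)\omega_j$. Put $T=t(S^* )\leqslant\operatorname{GL}(n,R)$. Extend $t$ by the same formula (with basis $1\otimes\omega_i$) to $\overline{k}\otimes_RS$ and put $\widetilde T=t((\overline{k}\otimes_RS)^* )\leqslant\operatorname{GL}(n,\overline{k})$. For groups $A\leqslant B$, $\mathrm{Lat}(A,B)=\{H: A\leqslant H\leqslant B\}$ is the lattice of intermediate subgroups. Its normality graph has the intermediate subgroups as vertices, two of them being joined by an edge iff one of them is normal in the other. A garland is a connected component of the normality graph; the lower garland is the one containing $A$. $N_{B}(\cdot)$ is the normalizer in $B$. *)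

(* Defs.v *)
From HB Require Import structures.
From Stdlib Require Import Relation_Operators.
From mathcomp Require Import all_boot all_order all_algebra.
From mathcomp Require Import mpoly.
From mathcomp Require Import boolp classical_sets.

Set Implicit Arguments.
Unset Strict Implicit.
Unset Printing Implicit Defensive.

Import GRing.Theory.

Local Open Scope classical_set_scope.
Local Open Scope ring_scope.

Definition is_basis (R : nzRingType) (V : lmodType R) (n : nat)
    (b : 'I_n -> V) : Prop :=
  forall v : V, exists! c : 'rV[R]_n, v = \sum_i c 0 i *: b i.

(* Meaningful when [b] is a basis; otherwise an arbitrary choice. *)
Definition coords (R : nzRingType) (V : lmodType R) (n : nat)
    (b : 'I_n -> V) (v : V) : 'rV[R]_n :=
  xget 0 [set c : 'rV[R]_n | v = \sum_i c 0 i *: b i].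

(* The matrix t(a) with b_i * a = \sum_j t(a)_(j, i) *: b_j: column i holds
   the coordinates of b_i * a. *)
Definition regular_mx (R : nzRingType) (A : algType R) (n : nat)
    (b : 'I_n -> A) (a : A) : 'M[R]_n :=
  \matrix_(j, i) coords b (b i * a) 0 j.

Definition regular_units (R : nzRingType) (A : unitAlgType R) (n : nat)
    (b : 'I_n -> A) : set 'M[R]_n :=
  [set regular_mx b a | a in [set a : A | a \is a GRing.unit]].

Definition SL (n : nat) (R : comNzRingType) : set 'M[R]_n :=
  [set M | \det M = 1].

Definition is_algebraic_closure (F : fieldType) (L : closedFieldType)
    (iota : {rmorphism F -> L}) : Prop :=
  forall x : L, algebraicOver iota x.

Definition frac_ext (R : idomainType) (L : fieldType)
    (iota : {rmorphism {fraction R} -> L}) : {rmorphism R -> L} :=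
  iota \o @FracField.tofrac R.

(* [A], with [j : x |-> 1 (x) x], is the K-algebra K (x)_R S: it is the
   K-module obtained from the R-module S by extension of scalars along
   [phi : R -> K] (stated by its universal property), with the ring structure
   for which [j] is multiplicative. *)
Definition is_scalar_extension (R K : comNzRingType) (phi : {rmorphism R -> K})
    (S : comAlgType R) (A : comAlgType K)
    (j : {lrmorphism S -> A | phi \; *:%R}) : Prop :=
  forall (M : lmodType K) (f : {linear S -> M | phi \; *:%R}),
    exists g : {linear A -> M},
      (forall x : S, g (j x) = f x) /\
      (forall h : {linear A -> M}, (forall x : S, h (j x) = f x) -> h =1 g).

Definition is_left_ideal (A : nzRingType) (I : set A) : Prop :=
  [/\ I 0, forall x y, I x -> I y -> I (x + y) & forall a x, I x -> I (a * x)].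

Definition is_simple_left_ideal (A : nzRingType) (I : set A) : Prop :=
  [/\ is_left_ideal I, I <> [set 0]
    & forall J : set A, is_left_ideal J -> J `<=` I -> J = [set 0] \/ J = I].

(* The left regular module is a direct sum of simple submodules; such a sum is
   finite because 1 lies in the sum of finitely many of them. *)
Definition is_semisimple (A : nzRingType) : Prop :=
  exists (m : nat) (I : 'I_m -> set A),
    (forall i, is_simple_left_ideal (I i)) /\
    (forall x : A, exists! y : {ffun 'I_m -> A},
       (forall i, I i (y i)) /\ x = \sum_i y i).

(* Zariski topology of the affine space of n x n matrices; the n * n variables
   are the matrix entries, listed by [mxvec]. *)
Definition zariski_closed (K : fieldType) (n : nat) (Z : set 'M[K]_n) : Prop :=
  exists E : set {mpoly K[n * n]},
    Z = [set M | forall p, E p -> p.@[fun i => mxvec M 0 i] = 0].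

Definition zariski_dense_in (K : fieldType) (n : nat) (X Y : set 'M[K]_n)
    : Prop :=
  X `<=` Y /\ forall Z, zariski_closed Z -> X `<=` Z -> Y `<=` Z.

Section MatrixGroups.
Variables (R : comUnitRingType) (n : nat).
Implicit Types A B G H : set 'M[R]_n.

Definition is_subgroup H : Prop :=
  [/\ H `<=` [set M | M \in unitmx], H 1%:M,
      forall g h, H g -> H h -> H (g *m h) & forall g, H g -> H (invmx g)].

Definition Lat A B : set (set 'M[R]_n) :=
  [set H | [/\ is_subgroup H, A `<=` H & H `<=` B]].

Definition conj_set A (g : 'M[R]_n) : set 'M[R]_n :=
  [set g *m h *m invmx g | h in A].

Definition is_normal_in H G : Prop :=
  H `<=` G /\ forall g, G g -> conj_set H g = H.

Definition normalizer B A : set 'M[R]_n :=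
  [set g | B g /\ conj_set A g = A].

Definition normality_edge A B H G : Prop :=
  [/\ Lat A B H, Lat A B G & is_normal_in H G \/ is_normal_in G H].

(* Connectedness by paths; [normality_edge] is symmetric. *)
Definition garland A B H : set (set 'M[R]_n) :=
  [set G | Lat A B G /\ clos_refl_trans _ (normality_edge A B) H G].

Definition lower_garland A B : set (set 'M[R]_n) := garland A B A.

End MatrixGroups.

(* Main.v *)
Require Import Defs.
From HB Require Import structures.
From Stdlib Require Import Relation_Operators.
From mathcomp Require Import all_boot all_order all_fingroup all_algebra.
From mathcomp Require Import abelian mpoly.
From mathcomp Require Import boolp classical_sets.

(** Every group between T' and its normalizer N normalizes T', hence is joined
to T' by an edge.  Conversely, the interval from T' to N is stable under edges:
the only real case is a group H with T' <= H <= N which is normal in a larger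
group G.  For g in G the conjugate g T' g^-1 lies in H, so it normalizes T',
and what has to be shown is that it lies in T'
([lower_garland_normalizer]).

This is a statement about tori.  Over the algebraic closure K, a semisimple
commutative algebra has a basis of orthogonal idempotents
([idempotent_basis]), so in a suitable basis of K^n the regular matrices of
units are exactly the invertible diagonal matrices
([regular_units_diagonalizable]), and those of determinant 1 form the torus D'
of diagonal matrices of determinant 1.  The condition that g x g^-1 conjugates
y to a diagonal matrix is polynomial in x and in y separately, so density
carries it from T' to D' ([zariski_dense_conj]): the conjugate of D' by g
normalizes D'.

It remains to see that such a conjugate lies in D'
([conj_torus_normalizing]).  As D' contains a matrix with pairwise distinct
diagonal entries, a matrix normalizing D' is monomial, and its power of
exponent m, the exponent of the symmetric group, is diagonal.  But D' is
divisible: each d in D' is e^m with e in D', so g d g^-1 = (g e g^-1)^m is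
diagonal.  Divisibility thus replaces the usual argument that a connected
group has no proper closed subgroup of finite index.

Finally one descends to R: the regular matrices of units are the invertible
matrices commuting with all regular matrices ([regular_unitsP]), and commuting
can be tested after the embedding of R into K. *)

Set Implicit Arguments.
Unset Strict Implicit.
Unset Printing Implicit Defensive.

Import GRing.Theory.

Local Open Scope classical_set_scope.
Local Open Scope ring_scope.

(** * Coordinates in a free module *)

Section Coordinates.
Variables (R : comNzRingType) (V : lmodType R) (n : nat) (b : 'I_n -> V).
Hypothesis b_basis : is_basis b.

Lemma coordsK v : v = \sum_i coords b v 0 i *: b i.
Proof.
have [c [vE _]] := b_basis v.
by have /= := xgetPex 0 (ex_intro (fun c : 'rV_n => v = \sum_i c 0 i *: b i) c vE).
Qed.

Lemma coords_unique v (c : 'rV_n) : v = \sum_i c 0 i *: b i -> coords b v = c.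
Proof.
move=> vE; have [c' [_ uniq_c]] := b_basis v.
by rewrite -(uniq_c _ vE) -(uniq_c _ (coordsK v)).
Qed.

Lemma coordsD u v : coords b (u + v) = coords b u + coords b v.
Proof.
apply: coords_unique; rewrite {1}(coordsK u) {1}(coordsK v) -big_split /=.
by apply: eq_bigr => i _; rewrite mxE scalerDl.
Qed.

Lemma coordsZ a v : coords b (a *: v) = a *: coords b v.
Proof.
apply: coords_unique; rewrite {1}(coordsK v) scaler_sumr.
by apply: eq_bigr => i _; rewrite mxE scalerA.
Qed.

Lemma coords0 : coords b 0 = 0.
Proof. by rewrite -(scale0r 0) coordsZ scale0r. Qed.

Lemma coords_sum (I : Type) (r : seq I) (P : pred I) (F : I -> V) :
  coords b (\sum_(i <- r | P i) F i) = \sum_(i <- r | P i) coords b (F i).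
Proof. exact: (big_morph _ coordsD coords0). Qed.

Lemma coords_comb (c : 'rV_n) : coords b (\sum_i c 0 i *: b i) = c.
Proof. exact: coords_unique. Qed.

Lemma coords_basis i : coords b (b i) = delta_mx 0 i.
Proof.
apply: coords_unique; rewrite (bigD1 i) //= mxE !eqxx scale1r big1 ?addr0 //.
by move=> k ki; rewrite mxE (negPf ki) andbF scale0r.
Qed.

Lemma coords_inj : injective (coords b).
Proof. by move=> u v uv; rewrite (coordsK u) uv -coordsK. Qed.

End Coordinates.

(** Over a nonzero commutative ring a one-sided inverse of rectangular matrices
already compares their sizes; the transition matrices give both inequalities. *)
Lemma is_basis_rank (R : comNzRingType) (V : lmodType R) (m n : nat)
    (b : 'I_m -> V) (e : 'I_n -> V) :
  is_basis b -> is_basis e -> m = n.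
Proof.
move=> bB eB.
have le_rank p q (c : 'I_p -> V) (d : 'I_q -> V) :
    is_basis c -> is_basis d -> (p <= q)%N.
  move=> cB dB.
  apply: (@mulmx1_min _ _ _ (\matrix_i coords d (c i)) (\matrix_i coords c (d i))).
  apply/row_matrixP => i; rewrite row_mul rowK row1 -(coords_basis cB i).
  rewrite mulmx_sum_row [in RHS](coordsK dB (c i)) coords_sum //.
  by apply: eq_bigr => k _; rewrite rowK coordsZ.
by apply/eqP; rewrite eqn_leq (le_rank _ _ b e) // (le_rank _ _ e b).
Qed.

(** * The regular representation of a commutative algebra *)

Section Regular.
Variables (R : comUnitRingType) (A : comUnitAlgType R) (n : nat) (b : 'I_n -> A).
Hypothesis b_basis : is_basis b.

Local Notation t := (regular_mx b).

Lemma regular_mx_coords a x : t a *m (coords b x)^T = (coords b (x * a))^T.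
Proof.
rewrite [in RHS](coordsK b_basis x) mulr_suml coords_sum //.
apply/colP => k; rewrite !mxE summxE; apply: eq_bigr => i _.
by rewrite -scalerAl coordsZ // !mxE mulrC.
Qed.

Lemma eq_on_coords (M N : 'M[R]_n) :
  (forall x, M *m (coords b x)^T = N *m (coords b x)^T) -> M = N.
Proof.
move=> MN; apply/matrixP => i k; move/matrixP: (MN (b k)) => /(_ i 0).
by rewrite coords_basis // trmx_delta -!colE !mxE.
Qed.

Lemma regular_mxM x y : t (x * y) = t x *m t y.
Proof.
apply: eq_on_coords => z.
by rewrite -mulmxA !regular_mx_coords mulrA -(mulrA z) (mulrC x) mulrA.
Qed.

Lemma regular_mx1 : t 1 = 1%:M.
Proof.
by apply: eq_on_coords => z; rewrite mul1mx regular_mx_coords mulr1.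
Qed.

Lemma regular_mx0 : t 0 = 0.
Proof.
apply: eq_on_coords => z.
by rewrite mul0mx regular_mx_coords mulr0 coords0 // trmx0.
Qed.

Lemma regular_mx_sub_scalar a c : t (a - c%:A) = t a - c%:M.
Proof.
apply: eq_on_coords => z; rewrite mulmxBl mul_scalar_mx !regular_mx_coords.
rewrite mulrBr -scalerAr mulr1 -scaleN1r coordsD // !coordsZ // scaleN1r.
by rewrite linearB linearZ.
Qed.

Lemma regular_mx_inj : injective t.
Proof.
move=> x y xy; apply: (coords_inj b_basis); apply: trmx_inj.
by rewrite -(mul1r x) -(mul1r y) -!regular_mx_coords xy.
Qed.

(** A commutative algebra is its own centralizer: a linear map commuting with
all multiplications is determined by the image of 1. *)
Lemma centralizer_regular_mx (M : 'M[R]_n) :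
  (forall x, M *m t x = t x *m M) -> exists a, M = t a.
Proof.
move=> Mt; pose c := (M *m (coords b 1)^T)^T.
exists (\sum_i c 0 i *: b i); apply: eq_on_coords => x.
rewrite regular_mx_coords -[in LHS](mul1r x) -regular_mx_coords mulmxA Mt.
rewrite -mulmxA -[M *m _]trmxK -/c -[in LHS](coords_comb b_basis c).
by rewrite regular_mx_coords mulrC.
Qed.

(** This description by equations, which mentions no inverse in the algebra,
is what makes membership compatible with extension of scalars: it is stable
under inverses and can be tested in any larger ring. *)
Lemma regular_unitsP (M : 'M[R]_n) : regular_units b M <->
  M \in unitmx /\ forall x, M *m t x = t x *m M.
Proof.
split=> [[a /= ua <-]|[uM Mt]].
  split=> [|x]; last by rewrite -!regular_mxM mulrC.
  case: (@mulmx1_unit _ _ (t a) (t a^-1)) => //.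
  by rewrite -regular_mxM divrr ?regular_mx1.
have [a Ma] := centralizer_regular_mx Mt.
have [a' Ma'] : exists a', invmx M = t a'.
  apply: centralizer_regular_mx => x; apply: (can_inj (mulKmx uM)).
  by rewrite mulmxA mulmxV // mul1mx mulmxA Mt -mulmxA mulmxV // mulmx1.
exists a => //=; apply/unitrP; exists a'.
suff aa' : a * a' = 1 by split; rewrite // mulrC.
by apply: regular_mx_inj; rewrite regular_mxM -Ma -Ma' mulmxV // regular_mx1.
Qed.

End Regular.

Lemma change_of_basis (R : comUnitRingType) (A : comUnitAlgType R) (n : nat)
    (b e : 'I_n -> A) :
  is_basis b -> is_basis e -> exists2 Q : 'M[R]_n, Q \in unitmx &
    forall a, regular_mx b a *m Q = Q *m regular_mx e a.
Proof.
pose Q (b e : 'I_n -> A) : 'M[R]_n := \matrix_(k, i) coords b (e i) 0 k.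
have QE (c d : 'I_n -> A) x : is_basis c -> is_basis d ->
    Q c d *m (coords d x)^T = (coords c x)^T.
  move=> cB dB; apply/colP => k; rewrite !mxE [in RHS](coordsK dB x).
  rewrite coords_sum // summxE; apply: eq_bigr => i _.
  by rewrite coordsZ // !mxE mulrC.
move=> bB eB; exists (Q b e) => [|a].
  have [] := @mulmx1_unit _ _ (Q b e) (Q e b); rewrite //.
  by apply: (eq_on_coords bB) => x; rewrite mul1mx -mulmxA !QE.
apply: (eq_on_coords eB) => x; rewrite -!mulmxA QE // !regular_mx_coords //.
by rewrite QE.
Qed.

(** * Extension of scalars *)

Section ScalarExtension.
Variables (R : comNzRingType) (S : comAlgType R) (n : nat) (omega : 'I_n -> S).
Hypothesis omega_basis : is_basis omega.
Variables (K : comNzRingType) (phi : {rmorphism R -> K}) (A : comAlgType K).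
Variable j : {lrmorphism S -> A | phi \; *:%R}.

Lemma lrmorphism_coords x : j x = \sum_i phi (coords omega x 0 i) *: j (omega i).
Proof.
rewrite {1}(coordsK omega_basis x) linear_sum; apply: eq_bigr => i _.
by rewrite linearZ.
Qed.

(** The universal property is applied twice: to the semilinear coordinate map of
[S], which yields coordinates [g] on [A], and to [j] itself, where uniqueness
shows that every element of [A] is the combination with coordinates [g]. *)
Lemma scalar_extension_basis :
  is_scalar_extension j -> is_basis (fun i => j (omega i)).
Proof.
move=> A_ext.
pose f x : 'rV[K]_n := map_mx phi (coords omega x).
have fB : zmod_morphism f.
  by move=> x y; rewrite /f -scaleN1r coordsD // coordsZ // scaleN1r raddfB.
have fZ : scalable_for (phi \; *:%R) f.
  by move=> a x; rewrite /f coordsZ // map_mxZ.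
pose fa := GRing.isZmodMorphism.Build _ _ f fB.
pose fs := GRing.isScalable.Build _ _ _ _ f fZ.
pose fl : {linear S -> 'rV[K]_n | phi \; *:%R} := HB.pack f fa fs.
have [g [gE _]] := A_ext _ fl.
pose h (c : 'rV[K]_n) := \sum_i c 0 i *: j (omega i).
have hB : zmod_morphism h.
  move=> c d; rewrite /h -sumrB; apply: eq_bigr => i _.
  by rewrite !mxE scalerBl.
have hZ : scalable h.
  move=> a c; rewrite /h scaler_sumr; apply: eq_bigr => i _.
  by rewrite mxE scalerA.
pose ha := GRing.isZmodMorphism.Build _ _ h hB.
pose hs := GRing.isScalable.Build _ _ _ _ h hZ.
pose hl : {linear 'rV[K]_n -> A} := HB.pack h ha hs.
have gj i : g (j (omega i)) = delta_mx 0 i.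
  by rewrite gE /= /f coords_basis // map_delta_mx.
have hg v : h (g v) = v.
  have [k [_ k_uniq]] := A_ext _ j.
  have hgj x : hl (g (j x)) = j x.
    rewrite gE /= /h [in RHS]lrmorphism_coords.
    by apply: eq_bigr => i _; rewrite mxE.
  exact: etrans (k_uniq (hl \o g) hgj v) (esym (k_uniq idfun (fun=> erefl) v)).
move=> v; exists (g v); split=> [|c ->]; first by rewrite -{1}(hg v).
rewrite linear_sum /= [RHS]row_sum_delta; apply: eq_bigr => i _.
by rewrite linearZ /= gj.
Qed.

End ScalarExtension.

Lemma regular_mx_ext (R : comUnitRingType) (S : comUnitAlgType R) (n : nat)
    (omega : 'I_n -> S) (K : comUnitRingType) (phi : {rmorphism R -> K})
    (A : comUnitAlgType K) (j : {lrmorphism S -> A | phi \; *:%R}) (s : S) :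
  is_basis omega -> is_basis (fun i => j (omega i)) ->
  regular_mx (fun i => j (omega i)) (j s) = map_mx phi (regular_mx omega s).
Proof.
move=> oB jB; apply/matrixP => l i; rewrite !mxE.
rewrite (coords_unique jB (c := map_mx phi (coords omega (omega i * s)))) ?mxE //.
rewrite -rmorphM; apply: etrans (lrmorphism_coords oB j _) _.
by apply: eq_bigr => k _; rewrite mxE.
Qed.

(** * Semisimple commutative algebras over an algebraically closed field *)

Section Semisimple.
Variables (K : closedFieldType) (A : comUnitAlgType K) (n : nat) (b : 'I_n -> A).
Hypothesis b_basis : is_basis b.

Lemma unital_algebra_rank_gt0 : (0 < n)%N.
Proof.
case: n b b_basis => // b0 b0B; have := oner_neq0 A.
by rewrite {1}(coordsK b0B 1) big_ord0 eqxx.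
Qed.

(** The Cayley-Hamilton theorem for the regular matrix of [a], whose
characteristic polynomial splits. *)
Lemma split_annihilator (a : A) : exists rs : seq K, \prod_(r <- rs) (a - r%:A) = 0.
Proof.
move: unital_algebra_rank_gt0 b_basis; case: n b => // m c _ cB.
have [rs pE] := closed_field_poly_normal (char_poly (regular_mx c a)).
exists rs; apply: (regular_mx_inj cB).
have -> : regular_mx c (\prod_(r <- rs) (a - r%:A)) =
    horner_mx (regular_mx c a) (char_poly (regular_mx c a)).
  rewrite pE (monicP (char_poly_monic _)) scale1r rmorph_prod /=.
  elim: rs {pE} => [|r rs IH]; first by rewrite !big_nil regular_mx1.
  rewrite !big_cons regular_mxM // IH regular_mx_sub_scalar //.
  by rewrite rmorphB /= horner_mx_X horner_mx_C.
by rewrite Cayley_Hamilton regular_mx0.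
Qed.

(** Schur's lemma.  Multiplying a nonzero element of [I] successively by the
factors of [split_annihilator] must give 0 at some step, which produces an
eigenvector; the eigenvectors for its eigenvalue form a nonzero subideal, which
is [I] by simplicity. *)
Lemma simple_ideal_scalar (I : set A) (a : A) :
  is_simple_left_ideal I -> exists l : K, forall x, I x -> a * x = l *: x.
Proof.
move=> [[I0 ID IM] Inz Isimple].
have [x [Ix xnz]] : exists x, I x /\ x != 0.
  apply: contrapT => no; apply: Inz; apply/seteqP; split=> [x Ix|x -> //] /=.
  by apply/eqP; apply: contrapT => /negP xnz; apply: no; exists x.
have [rs] := split_annihilator a.
move/(congr1 ( *%R^~ x)); rewrite mul0r.
elim: rs x Ix xnz => [|r rs IH] x Ix xnz.
  by rewrite big_nil mul1r => /eqP; rewrite (negPf xnz).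
rewrite big_cons mulrAC mulrC => prod0.
have [y0|ynz] := eqVneq ((a - r%:A) * x) 0; last first.
  by apply: IH ynz prod0; apply: IM.
exists r => y Iy.
pose J := [set z | I z /\ (a - r%:A) * z = 0].
have [] := Isimple J.
- split; first by rewrite /J /= mulr0.
  + by move=> u v [Iu u0] [Iv v0]; split; [apply: ID | rewrite mulrDr u0 v0 addr0].
  + by move=> c u [Iu u0]; split; [apply: IM | rewrite mulrCA u0 mulr0].
- by move=> z [].
- move=> J0; have : J x by [].
  by rewrite J0 /= => x0; rewrite x0 eqxx in xnz.
- move=> JI; have : J y by rewrite JI.
  by case=> _ /eqP; rewrite mulrBl subr_eq0 -scalerAl mul1r => /eqP.
Qed.

(** The components of 1 in the decomposition into simple ideals are orthogonal
idempotents.  By Schur's lemma each ideal is the line spanned by its component,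
so these components form a basis, and their number is the rank. *)
Lemma idempotent_basis : is_semisimple A -> exists2 e : 'I_n -> A,
  is_basis e & forall i k, e i * e k = e i *+ (i == k).
Proof.
move=> [m [I [Isimple Idec]]].
have IM i a x : I i x -> I i (a * x) by case: (Isimple i) => -[_ _ +] _ _; apply.
have [e [[Ie sum_e] _]] := Idec 1.
have eI i x k : I i x -> x * e k = x *+ (i == k).
  move=> Ix; have [y [_ y_uniq]] := Idec x.
  have y1 : y = [ffun k => x * e k].
    apply: y_uniq; split=> [l|]; first by rewrite ffunE; apply: IM.
    under eq_bigr do rewrite ffunE.
    by rewrite -mulr_sumr -sum_e mulr1.
  have y2 : y = [ffun k => x *+ (i == k)].
    apply: y_uniq; split=> [l|].
      rewrite ffunE; case: eqP => [<- //|_]; rewrite mulr0n.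
      by case: (Isimple l) => -[].
    rewrite (bigD1 i) //= ffunE eqxx big1 ?addr0 // => l.
    by rewrite eq_sym ffunE => /negPf ->.
  by move/ffunP: (etrans (esym y1) y2) => /(_ k); rewrite !ffunE.
have e_nz i : e i != 0.
  apply/eqP => ei0; case: (Isimple i) => -[I0 _ _] Inz _; apply: Inz.
  apply/seteqP; split=> [x Ix|x -> //] /=.
  by have := eI i x i Ix; rewrite ei0 mulr0 eqxx.
have eB : is_basis e.
  move=> v.
  have l_ex i : exists l, v * e i = l *: e i.
    by have [l lE] := simple_ideal_scalar v (Isimple i); exists l; apply: lE.
  pose l i := projT1 (cid (l_ex i)).
  have lE i : v * e i = l i *: e i := projT2 (cid (l_ex i)).
  exists (\row_i l i); split=> [|c vE].
    rewrite -[LHS]mulr1 sum_e mulr_sumr; apply: eq_bigr => i _.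
    by rewrite mxE lE.
  apply/rowP => i; rewrite mxE; apply/eqP; rewrite -subr_eq0.
  suff : (l i - c 0 i) *: e i == 0 by rewrite scaler_eq0 (negPf (e_nz i)) orbF.
  rewrite scalerBl -lE {1}vE mulr_suml (bigD1 i) //= big1 ?addr0.
    by rewrite -scalerAl (eI i) // eqxx mulr1n subrr.
  by move=> k ki; rewrite -scalerAl (eI k) // (negPf ki) mulr0n scaler0.
have mn := is_basis_rank eB b_basis; subst m.
by exists e => // i k; apply: eI.
Qed.

End Semisimple.

(** In a basis of orthogonal idempotents the regular matrix of [a] is diagonal,
with the coordinates of [a] on the diagonal, so the matrices commuting with all
of them are the diagonal ones. *)
Lemma regular_units_diagonalizable (K : closedFieldType) (A : comUnitAlgType K)
    (n : nat) (b : 'I_n -> A) :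
  is_basis b -> is_semisimple A -> exists2 Q : 'M[K]_n, Q \in unitmx &
    forall M, regular_units b M <->
      M \in unitmx /\ is_diag_mx (invmx Q *m M *m Q).
Proof.
move=> bB /(idempotent_basis bB)[e eB e_orth].
have diag_e a : regular_mx e a = diag_mx (coords e a).
  have ea i : coords e (e i * a) = coords e a 0 i *: delta_mx 0 i.
    rewrite -(coords_basis eB) -coordsZ // [a in LHS](coordsK eB) mulr_sumr.
    rewrite (bigD1 i) //= -scalerAr e_orth eqxx big1 ?addr0 // => k.
    by rewrite -scalerAr e_orth eq_sym => /negPf ->; rewrite scaler0.
  by apply/matrixP => k i; rewrite !mxE ea !mxE eqxx mulr_natr; case: eqP => [->|].
have [Q uQ bQ] := change_of_basis bB eB; exists Q => // M.
pose c M := invmx Q *m M *m Q.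
have cM M1 M2 : c (M1 *m M2) = c M1 *m c M2.
  by rewrite /c !mulmxA mulmxK.
have c_inj : injective c.
  by move=> M1 M2; rewrite /c => /(can_inj (mulmxK uQ)) /(can_inj (mulKVmx uQ)).
have cb a : c (regular_mx b a) = diag_mx (coords e a).
  by rewrite /c -mulmxA bQ mulKmx // diag_e.
rewrite regular_unitsP //; split=> -[uM MP]; split=> //; last first.
  move=> a; apply: c_inj; rewrite !cM cb.
  have /diag_mxP[d] := MP; rewrite -/(c M) => ->; exact: diag_mxC.
(* commuting with the projection onto the i-th axis kills the i-th row off the
   diagonal *)
apply/is_diag_mxP => i k ik.
have /(congr1 c) := MP (e i); rewrite !cM cb coords_basis // => /matrixP/(_ i k).
rewrite mul_mx_diag mul_diag_mx !mxE !eqxx mul1r => <-.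
by rewrite [k == i]eq_sym -val_eqE (negPf ik) mulr0.
Qed.

(** * Monomial matrices and the diagonal torus *)

Section Monomial.
Variables (K : fieldType) (n : nat).

(** Entries on the graph of [s] may vanish, so that products and powers stay in
the class without any invertibility condition. *)
Definition monomial_for (s : 'S_n) (M : 'M[K]_n) : Prop :=
  forall i k, k != s i -> M i k = 0.

Lemma monomial_forM s s' M M' :
  monomial_for s M -> monomial_for s' M' -> monomial_for (s * s')%g (M *m M').
Proof.
move=> sM sM' i k; rewrite permM => ks; rewrite mxE big1 // => l _.
have [->|ls] := eqVneq l (s i); first by rewrite sM' ?mulr0.
by rewrite sM ?mul0r.
Qed.

Lemma monomial_for1 : monomial_for 1%g 1%:M.
Proof. by move=> i k; rewrite perm1 mxE eq_sym => /negPf ->. Qed.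

Lemma monomial_forX s M m : monomial_for s M -> monomial_for (s ^+ m)%g (M ^+ m).
Proof.
move=> sM; elim: m => [|m IH]; first exact: monomial_for1.
by rewrite expgS exprS; apply: monomial_forM.
Qed.

Lemma monomial_exponent_diag s M :
  monomial_for s M -> is_diag_mx (M ^+ exponent [set: 'S_n]%SET).
Proof.
move=> /(@monomial_forX _ _ (exponent [set: 'S_n]%SET)) sM.
apply/is_diag_mxP => i k ik; rewrite sM //.
by rewrite expg_exponent ?inE // perm1 -val_eqE eq_sym.
Qed.

(** If [M] conjugates diag(d) to diag(d'), then [M i k] can be nonzero only when
[d k = d' i]; as the entries of [d] are distinct, each row has at most one
nonzero entry.  A nonzero term of the determinant expansion shows that these
entries follow a permutation. *)
Lemma normalizing_regular_diag (d : 'rV[K]_n) (M : 'M[K]_n) :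
  injective (d 0) -> M \in unitmx -> is_diag_mx (M *m diag_mx d *m invmx M) ->
  exists s, monomial_for s M.
Proof.
move=> d_inj uM /diag_mxP[d' d'E].
have {}d'E i k : M i k * d 0 k = d' 0 i * M i k.
  have : M *m diag_mx d = diag_mx d' *m M by rewrite -d'E mulmxKV.
  by rewrite mul_mx_diag mul_diag_mx => /matrixP/(_ i k); rewrite !mxE.
have eq_d i k : M i k != 0 -> d 0 k = d' 0 i.
  by move=> Mik; apply: (mulfI Mik); rewrite d'E mulrC.
have [s Ms] : exists s : 'S_n, \prod_i M i (s i) != 0.
  apply: contrapT => noS; move: uM; rewrite unitmxE unitfE => /eqP; apply.
  rewrite /determinant big1 // => s _.
  have [->|Ms] := eqVneq (\prod_i M i (s i)) 0; first by rewrite mulr0.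
  by case: noS; exists s.
exists s => i k ks; apply/eqP; apply: contraNT ks => Mik.
have Msi : M i (s i) != 0 by move/prodf_neq0: Ms; apply.
by apply/eqP/d_inj; rewrite (eq_d _ _ Mik) (eq_d _ _ Msi).
Qed.

End Monomial.

Section DiagonalTorus.
Variables (K : closedFieldType) (n : nat).

Lemma closed_field_root m (c : K) : (0 < m)%N -> exists x, x ^+ m = c.
Proof.
move=> m_gt0; have /closed_rootP[x] : size ('X^m - c%:P) != 1%N.
  by rewrite size_XnsubC // eqSS -lt0n.
by rewrite rootE !hornerE subr_eq0 => /eqP; exists x.
Qed.

(** An algebraically closed field is infinite: a root of 1 + prod (X - a) is
different from every [a]. *)
Lemma closed_field_uniq_nonzero m : exists2 s : seq K, size s = m & uniq (0 :: s).
Proof.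
elim: m => [|m [s sm s_uniq]]; first by exists [::].
have /closed_rootP[x] : size (1 + \prod_(a <- 0 :: s) ('X - a%:P)) != 1%N.
  by rewrite addrC size_polyDl size_prod_XsubC ?size_poly1.
rewrite rootE !hornerE => x_root.
have xs : x \notin 0 :: s.
  rewrite -root_prod_XsubC rootE; apply: contraTneq x_root => ->.
  by rewrite addr0 oner_neq0.
exists (x :: s); first by rewrite /= sm.
move: xs s_uniq; rewrite /= !inE !negb_or => /andP[x0 xs] /andP[s0 ->].
by rewrite eq_sym x0 s0 xs.
Qed.

(** Distinct nonzero entries can be rescaled to have product 1, by a root of the
inverse of their product. *)
Lemma torus_regular : exists2 d : 'rV[K]_n, injective (d 0) & \prod_i d 0 i = 1.
Proof.
case: n => [|m]; first by exists 0; [case | rewrite big_ord0].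
have [s sn /=/andP[s0 s_uniq]] := closed_field_uniq_nonzero m.+1.
have [c cE] := closed_field_root (\prod_(i < m.+1) s`_i)^-1 (ltn0Sn m).
have s_nz (i : 'I_m.+1) : s`_i != 0.
  by apply: contraNneq s0 => <-; rewrite mem_nth ?sn.
have p_nz : \prod_(i < m.+1) s`_i != 0 by apply/prodf_neq0.
have c_nz : c != 0.
  by apply: contra_eq_neq cE => ->; rewrite expr0n /= eq_sym invr_eq0.
exists (\row_i (c * s`_i)) => [i k|].
  rewrite !mxE => /(mulfI c_nz)/eqP; rewrite nth_uniq ?sn // => /eqP.
  exact: ord_inj.
under eq_bigr do rewrite mxE.
by rewrite big_split /= prodr_const card_ord cE mulVf.
Qed.

(** Roots of the entries have as product a root of unity [p], so dividing one of
them by [p] makes the product 1 without changing its power. *)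
Lemma torus_divisible m (d : 'rV[K]_n) : (0 < m)%N -> \prod_i d 0 i = 1 ->
  exists2 e : 'rV[K]_n, \prod_i e 0 i = 1 & diag_mx e ^+ m = diag_mx d.
Proof.
move=> m_gt0 d1.
have diagX (e : 'rV[K]_n) : diag_mx e ^+ m = diag_mx (\row_i e 0 i ^+ m).
  elim: m {m_gt0} => [|m IH].
    by apply/matrixP => i k; rewrite expr0 !mxE expr0; case: eqP.
  rewrite exprS IH -[_ * _]/(_ *m _) mul_diag_mx; apply/matrixP => i k.
  by rewrite !mxE exprS; case: eqP => [->|]; rewrite ?mulr0n ?mulr0.
case: n d d1 diagX => [|l] d d1 diagX.
  by exists d => //; apply/matrixP => -[].
have [r rE] : exists r : 'I_l.+1 -> K, forall i, r i ^+ m = d 0 i.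
  have rt i := closed_field_root (d 0 i) m_gt0.
  by exists (fun i => projT1 (cid (rt i))) => i; apply: (projT2 (cid (rt i))).
pose p := \prod_i r i.
have pm : p ^+ m = 1 by rewrite -prodrXl (eq_bigr _ (fun i _ => rE i)).
have p_nz : p != 0.
  by apply: contra_eq_neq pm => ->; rewrite expr0n gtn_eqF // eq_sym oner_neq0.
exists (\row_i (r i * (if i == ord0 then p^-1 else 1))).
  under eq_bigr do rewrite mxE.
  by rewrite big_split /= -big_mkcond big_pred1_eq mulfV.
rewrite diagX; congr diag_mx; apply/rowP => i; rewrite !mxE exprMn rE.
by case: eqP; rewrite ?exprVn ?pm ?invr1 ?expr1n mulr1.
Qed.

(** For a conjugate of the diagonal torus, normalizing the torus forces being
contained in it: an element of the conjugate is a power, with exponent that of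
the symmetric group, of another one, which is monomial. *)
Lemma conj_torus_normalizing (h : 'M[K]_n) : h \in unitmx ->
  (forall d1 d2 : 'rV[K]_n, \prod_i d1 0 i = 1 -> \prod_i d2 0 i = 1 ->
    is_diag_mx (h *m diag_mx d1 *m invmx h *m diag_mx d2 *m
      invmx (h *m diag_mx d1 *m invmx h))) ->
  forall d : 'rV[K]_n, \prod_i d 0 i = 1 -> is_diag_mx (h *m diag_mx d *m invmx h).
Proof.
move=> uh h_norm d d1.
have [e e1 eX] := torus_divisible (exponent_gt0 [set: 'S_n]) d1.
have conjX m : (h *m diag_mx e *m invmx h) ^+ m = h *m diag_mx e ^+ m *m invmx h.
  elim: m => [|m IH]; first by rewrite !expr0 mulmx1 mulmxV.
  by rewrite !exprS IH -![_ * _]/(_ *m _) !mulmxA mulmxKV.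
have [c c_inj c1] := torus_regular.
have ue : h *m diag_mx e *m invmx h \in unitmx.
  by rewrite !unitmx_mul unitmx_inv uh unitmxE det_diag e1 unitr1.
have [s sM] := normalizing_regular_diag c_inj ue (h_norm e c e1 c1).
by rewrite -eX -conjX; apply: monomial_exponent_diag sM.
Qed.

End DiagonalTorus.

(** * Polynomial conditions on matrices *)

Section Zariski.
Variables (K : fieldType) (n : nat).

Definition generic_mx : 'M[{mpoly K[n * n]}]_n := vec_mx (\row_k 'X_k).

Definition eval_mx (M : 'M[K]_n) (F : 'M[{mpoly K[n * n]}]_n) : 'M[K]_n :=
  map_mx (meval (fun k => mxvec M 0 k)) F.

Lemma eval_generic M : eval_mx M generic_mx = M.
Proof.
rewrite /eval_mx /generic_mx map_vec_mx -[RHS]mxvecK; congr vec_mx.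
by apply/rowP => k; rewrite !mxE mevalXU.
Qed.

Lemma eval_const M C : eval_mx M (map_mx (@mpolyC (n * n) K) C) = C.
Proof. by apply/matrixP => i k; rewrite !mxE mevalC. Qed.

Lemma eval_mul M F G : eval_mx M (F *m G) = eval_mx M F *m eval_mx M G.
Proof. exact: map_mxM. Qed.

Lemma eval_adj M F : eval_mx M (\adj F) = \adj (eval_mx M F).
Proof. exact: map_mx_adj. Qed.

Lemma zariski_dense_diag (X Y : set 'M[K]_n) (F : 'M[{mpoly K[n * n]}]_n) :
  zariski_dense_in X Y -> (forall M, X M -> is_diag_mx (eval_mx M F)) ->
  forall M, Y M -> is_diag_mx (eval_mx M F).
Proof.
move=> [_ XY] XF M YM.
pose E := [set p | exists i k : 'I_n, i != k :> nat /\ p = F i k].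
have MF : [set N | forall p, E p -> p.@[fun k => mxvec N 0 k] = 0] M.
  apply: XY YM => [|N /XF/is_diag_mxP NF p [i [k [ik ->]]]]; first by exists E.
  by have := NF i k ik; rewrite mxE.
apply/is_diag_mxP => i k ik; rewrite mxE.
by apply: MF; exists i, k.
Qed.

Lemma det1_invmx (M : 'M[K]_n) : \det M = 1 -> invmx M = \adj M.
Proof. by move=> dM; rewrite /invmx unitmxE dM unitr1 invr1 scale1r. Qed.

(** The condition is polynomial in each variable, because the inverse of a matrix
of determinant 1 is its adjugate.  Density is therefore used once in [x], with
[y] in [X], and then once in [y]. *)
Lemma zariski_dense_conj (X Y : set 'M[K]_n) (P P' g : 'M[K]_n) :
  zariski_dense_in X Y -> Y `<=` @SL n K -> 
  let c x y := P *m (g *m x *m invmx g *m y *m (g *m invmx x *m invmx g)) *m P' in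
  (forall x y, X x -> X y -> is_diag_mx (c x y)) ->
  forall x y, Y x -> Y y -> is_diag_mx (c x y).
Proof.
move=> XY YSL c Xc.
have XX : X `<=` Y by case: XY.
pose C := map_mx (@mpolyC (n * n) K) : 'M_n -> 'M_n.
have Yc x y : Y x -> X y -> is_diag_mx (c x y).
  move=> Yx Xy.
  pose F := C P *m (C g *m generic_mx *m C (invmx g) *m C y *m
    (C g *m \adj generic_mx *m C (invmx g))) *m C P'.
  have FE z : Y z -> eval_mx z F = c z y.
    move=> /YSL zSL; rewrite !eval_mul eval_adj !eval_const eval_generic.
    by rewrite -det1_invmx.
  rewrite -FE //; apply: zariski_dense_diag XY _ x Yx => z Xz.
  by rewrite FE; [apply: Xc | apply: XX].
move=> x y Yx Yy.
pose F := C P *m (C (g *m x *m invmx g) *m generic_mx *m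
  C (g *m invmx x *m invmx g)) *m C P'.
have FE z : eval_mx z F = c x z.
  by rewrite !eval_mul !eval_const eval_generic.
rewrite -FE; apply: zariski_dense_diag XY _ y Yy => z Xz.
by rewrite FE; apply: Yc.
Qed.

End Zariski.

(** * Lower garlands *)

Section Groups.
Variables (R : comUnitRingType) (n : nat).
Implicit Types A B G H : set 'M[R]_n.

Lemma invmxM (g h : 'M[R]_n) : g \in unitmx -> h \in unitmx ->
  invmx (g *m h) = invmx h *m invmx g.
Proof.
move=> ug uh; have ugh : g *m h \in unitmx by rewrite unitmx_mul ug.
apply: (can_inj (mulKmx ugh)).
by rewrite mulmxV // mulmxA mulmxK // mulmxV.
Qed.

Lemma invmx_conj (g x : 'M[R]_n) : g \in unitmx -> x \in unitmx ->
  invmx (g *m x *m invmx g) = g *m invmx x *m invmx g.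
Proof.
move=> ug ux; rewrite !invmxM ?unitmx_mul ?unitmx_inv ?ug //.
by rewrite invmxK mulmxA.
Qed.

Lemma SL_unit (g : 'M[R]_n) : SL g -> g \in unitmx.
Proof. by move=> g1; rewrite unitmxE g1 unitr1. Qed.

Lemma SL_inv (g : 'M[R]_n) : SL g -> SL (invmx g).
Proof. by move=> g1; rewrite /SL /= det_inv g1 invr1. Qed.

Lemma SL_mul (g h : 'M[R]_n) : SL g -> SL h -> SL (g *m h).
Proof. by move=> g1 h1; rewrite /SL /= det_mulmx g1 h1 mulr1. Qed.

Lemma conj_set_eq A g : g \in unitmx ->
  conj_set A g `<=` A -> conj_set A (invmx g) `<=` A -> conj_set A g = A.
Proof.
move=> ug gA g'A; apply/seteqP; split=> // x Ax.
exists (invmx g *m x *m g).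
  by apply: g'A; exists x => //; rewrite invmxK.
by rewrite !mulmxA mulmxV // mul1mx mulmxK.
Qed.

Lemma subgroup_conj H g : is_subgroup H -> H g -> conj_set H g = H.
Proof.
move=> [Hu _ HM HV] Hg; apply: conj_set_eq; first exact: Hu.
  by move=> _ [x Hx <-]; apply: HM (HM _ _ Hg Hx) (HV _ Hg).
move=> _ [x Hx <-]; rewrite invmxK.
exact: HM (HM _ _ (HV _ Hg) Hx) Hg.
Qed.

(** Along an edge from [H] up to a group [G] in which [H] is normal, the
conjugates of [A] by elements of [G] stay in [H], hence normalize [A]; the last
hypothesis brings them back into [A]. *)
Lemma lower_garland_normalizer A B : is_subgroup A -> is_subgroup B -> A `<=` B ->
  (forall g, B g -> conj_set A g `<=` normalizer B A -> conj_set A g `<=` A) ->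
  lower_garland A B = Lat A (normalizer B A).
Proof.
move=> Agrp [Bu B1 BM BV] AB pinned.
have AN : A `<=` normalizer B A.
  by move=> g Ag; split; [apply: AB | apply: subgroup_conj].
have NB : normalizer B A `<=` B by move=> g [].
have LatA : Lat A B A by split.
apply/seteqP; split=> [G [_ AG]|H [Hgrp AH HN]]; last first.
  have LatH : Lat A B H by split=> // x /HN/NB.
  split=> //; apply: rt_step; split=> //; left; split=> // g Hg.
  by have [] := HN g Hg.
suff step H G' : clos_refl_trans _ (normality_edge A B) H G' ->
    Lat A (normalizer B A) H -> Lat A (normalizer B A) G'.
  by apply: step AG _; split.
elim=> {AG H G G'} [H G [_ [Ggrp AG GB] HG]| |H G G' _ IH1 _ IH2 /IH1/IH2] //.
move=> [Hgrp AH HN]; split=> //.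
case: HG => [[_ GH]|[GH _]]; last by move=> x /GH/HN.
have conjA g : G g -> conj_set A g `<=` A.
  move=> Gg; apply: pinned; first exact: GB.
  apply: subset_trans HN; rewrite -(GH g Gg).
  by move=> _ [x Ax <-]; exists x => //; apply: AH.
have [_ _ _ GV] := Ggrp.
move=> g Gg; split; first exact: GB.
by apply: conj_set_eq; [apply/Bu/GB | apply: conjA | apply/conjA/GV].
Qed.

End Groups.

(** * The theorem *)

Lemma regular_SL_subgroup (R : comUnitRingType) (S : comUnitAlgType R) (n : nat)
    (b : 'I_n -> S) :
  is_basis b -> is_subgroup (regular_units b `&` @SL n R).
Proof.
move=> bB; split=> [g [_ /SL_unit] //||g h [Tg g1] [Th h1]|g [Tg g1]].
- split; last by rewrite /SL /= det1.
  by apply/(regular_unitsP bB); rewrite unitmx1; split=> // x; rewrite mul1mx mulmx1.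
- split; last exact: SL_mul.
  move: Tg Th => /(regular_unitsP bB)[ug gC] /(regular_unitsP bB)[uh hC].
  apply/(regular_unitsP bB); rewrite unitmx_mul ug; split=> // x.
  by rewrite -mulmxA hC !mulmxA gC.
split; last exact: SL_inv.
move: Tg => /(regular_unitsP bB)[ug gC].
apply/(regular_unitsP bB); rewrite unitmx_inv; split=> // x.
apply: (can_inj (mulKmx ug)); apply: (can_inj (mulmxK ug)).
by rewrite mulKVmx // -!mulmxA mulVmx // mulmx1 gC.
Qed.

Lemma SL_subgroup (R : comUnitRingType) (n : nat) : is_subgroup (@SL n R).
Proof.
split=> [g /SL_unit //||g h|g]; [exact: det1 | exact: SL_mul | exact: SL_inv].
Qed.

Theorem theorem7p3
  (R : idomainType) (S : comUnitAlgType R)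
  (R_sub_S : injective (fun a : R => a%:A : S))
  (n : nat) (omega : 'I_n -> S) (omega_basis : is_basis omega)
  (kbar : closedFieldType) (iota : {rmorphism {fraction R} -> kbar})
  (kbar_closure : is_algebraic_closure iota)
  (A : comUnitAlgType kbar)
  (j : {lrmorphism S -> A | frac_ext iota \; *:%R})
  (A_tensor : is_scalar_extension j)
  (A_semisimple : is_semisimple A) :
  let T := regular_units omega in
  let T' := T `&` @SL n R in
  let tT := regular_units (fun i => j (omega i)) in
  zariski_dense_in [set map_mx (frac_ext iota) M | M in T']
    (tT `&` @SL n kbar) ->
  lower_garland T' (@SL n R) = Lat T' (normalizer (@SL n R) T').
Proof.
move=> T T' tT dense.
pose phi := frac_ext iota.
have phi_mx_inj : injective (map_mx phi : 'M_n -> 'M_n).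
  move=> M N /matrixP MN; apply/matrixP => i k; have := MN i k.
  by rewrite !mxE => /fmorph_inj/eqP; rewrite tofrac_eq => /eqP.
have jB := scalar_extension_basis omega_basis A_tensor.
have [Q uQ tTE] := regular_units_diagonalizable jB A_semisimple.
have map_SL (M : 'M_n) : SL M -> SL (map_mx phi M).
  by move=> M1; rewrite /SL /= det_map_mx M1 rmorph1.
have map_inv (M : 'M_n) : SL M -> map_mx phi (invmx M) = invmx (map_mx phi M).
  move=> M1; have uM := SL_unit M1; have uM' := SL_unit (map_SL _ M1).
  by rewrite -[LHS](mulKmx uM') -map_mxM mulmxV // map_mx1 mulmx1.
(* commuting with the regular matrices of [S] is tested over [kbar] *)
have T_descent (M : 'M_n) : SL M ->
    is_diag_mx (invmx Q *m map_mx phi M *m Q) -> T' M.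
  move=> M1 MQ; split=> //; apply/(regular_unitsP omega_basis).
  have /tTE/(regular_unitsP jB)[_ MC] : map_mx phi M \in unitmx /\
    is_diag_mx (invmx Q *m map_mx phi M *m Q) by rewrite SL_unit //; apply: map_SL.
  split=> [|x]; first exact: SL_unit.
  apply: phi_mx_inj; rewrite !map_mxM.
  by have := MC (j x); rewrite (regular_mx_ext x omega_basis jB).
have T'_diag M : T' M -> is_diag_mx (invmx Q *m map_mx phi M *m Q).
  move=> T'M; have [/(_ (map_mx phi M))[|/tTE[]//]] := dense.
  by exists M.
have T'grp : is_subgroup T' by apply: regular_SL_subgroup.
apply: lower_garland_normalizer => //; [exact: SL_subgroup | by move=> M [] |].
move=> g g1 gN; pose g' := map_mx phi g.
have ug' : g' \in unitmx by apply/SL_unit/map_SL.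
have map_conj x : map_mx phi (g *m x *m invmx g) = g' *m map_mx phi x *m invmx g'.
  by rewrite !map_mxM map_inv.
have conj_diag x y : (tT `&` @SL n kbar) x -> (tT `&` @SL n kbar) y ->
    is_diag_mx (invmx Q *m (g' *m x *m invmx g' *m y *m
      (g' *m invmx x *m invmx g')) *m Q).
  apply: (zariski_dense_conj dense) x y => [x []//|_ _ [x T'x <-] [y T'y <-]].
  have x1 : SL x by case: T'x.
  have gx1 : SL (g *m x *m invmx g).
    by apply: SL_mul; [apply: SL_mul | apply: SL_inv].
  have [|_ gxN] := gN (g *m x *m invmx g); first by exists x.
  rewrite -(map_inv x) // -!map_conj -map_mxM -invmx_conj ?SL_unit //.
  rewrite -map_mxM; apply: T'_diag; rewrite -gxN.
  by exists y.
(* in the coordinates given by [Q], conjugation by [g] is conjugation by [h] *)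
pose h := invmx Q *m g' *m Q.
have uh : h \in unitmx by rewrite !unitmx_mul unitmx_inv uQ ug'.
have hE : invmx h = invmx Q *m invmx g' *m Q.
  by rewrite /h !invmxM ?unitmx_mul ?unitmx_inv ?uQ // invmxK mulmxA.
pose D d := Q *m diag_mx d *m invmx Q.
have uD (d : 'rV[kbar]_n) : \prod_i d 0 i = 1 -> diag_mx d \in unitmx.
  by move=> d1; rewrite unitmxE det_diag d1 unitr1.
have DT (d : 'rV_n) : \prod_i d 0 i = 1 -> (tT `&` @SL n kbar) (D d).
  move=> d1; have uDd := uD d d1; split.
    apply/tTE; rewrite !unitmx_mul unitmx_inv uQ uDd; split=> //.
    by rewrite /D !mulmxA mulVmx // mul1mx mulmxKV // diag_mx_is_diag.
  by rewrite /SL /= !det_mulmx det_diag d1 mulr1 det_inv divrr.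
have h_norm (d1 d2 : 'rV_n) : \prod_i d1 0 i = 1 -> \prod_i d2 0 i = 1 ->
    is_diag_mx (h *m diag_mx d1 *m invmx h *m diag_mx d2 *m
      invmx (h *m diag_mx d1 *m invmx h)).
  move=> d11 d21; have := conj_diag _ _ (DT _ d11) (DT _ d21).
  by rewrite (invmx_conj uQ) ?uD // (invmx_conj uh) ?uD // hE /h /D !mulmxA.
move=> _ [x T'x <-]; have x1 : SL x by case: T'x.
apply: T_descent.
  by apply: SL_mul; [apply: SL_mul | apply: SL_inv].
have /diag_mxP[d dE] := T'_diag _ T'x.
have xE : map_mx phi x = D d by rewrite /D -dE !mulmxA mulmxV // mul1mx mulmxK.
have d1 : \prod_i d 0 i = 1.
  by rewrite -det_diag -dE !det_mulmx mulrAC det_inv mulVr // mul1r map_SL.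
have := conj_torus_normalizing uh h_norm d1.
by rewrite map_conj xE hE /h /D !mulmxA.
Qed.
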